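(* Let $\gamma$ be an ellipse and consider a 1-parameter family of billiard $n$-gons in $\gamma$. For a billiard $n$-gon $M_1,\dots,M_n$ of the family, the tangent lines to $\gamma$ at the impact points $M_i$ form a new polygon, whose angles are denoted by $\beta_i$, where $\beta_i$ is the angle at the intersection of the tangent lines at $M_i$ and $M_{i+1}$. Then the product $$\prod_{i=1}^{n}\cos\beta_i$$ is constant, that is, it has the same value for all billiard $n$-gons of the family.
   Context: A billiard $n$-gon $M_1,\dots,M_n$ ($M_{n+1}=M_1$, $n\ge 3$) in $\gamma$ is a closed $n$-periodic billiard trajectory inside $\gamma$: $M_i\in\gamma$, $M_i\ne M_{i+1}$, and at each $M_i$ the segments $M_{i-1}M_i$ and $M_iM_{i+1}$ obey the law of reflection (equal angles with the tangent line to $\gamma$ at $M_i$). By the Poncelet Porism, periodic billiard orbits in an ellipse come in 1-parameter families: if one billiard trajectory whose sides (extended to lines) are tangent to a given conic confocal with $\gamma$ closes up after $n$ steps, then so does every billiard trajectory tangent to that conic. The 1-parameter family of billiard $n$-gons consists of all billiard $n$-gons tangent to the same fixed confocal conic. Angle convention: if $\psi_i$ denotes the direction of the outer normal to $\gamma$ at $M_i$ (outer unit normal $(\cos\psi_i,\sin\psi_i)$), then $\beta_i=\pi-(\psi_{i+1}-\psi_i)$, so $\cos\beta_i=-\cos(\psi_{i+1}-\psi_i)$. *)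

(* Defs.v *)
From mathcomp Require Import all_boot all_order all_algebra.
From mathcomp Require Import reals trigo.

Set Implicit Arguments.
Unset Strict Implicit.
Unset Printing Implicit Defensive.

Import Order.TTheory GRing.Theory Num.Theory.

Local Open Scope ring_scope.

(* The norm that the library puts on R * R is the sup norm, hence the explicit
   Euclidean structure. *)
Definition dot (R : realType) (u v : R * R) : R := u.1 * v.1 + u.2 * v.2.

Definition enorm (R : realType) (u : R * R) : R := Num.sqrt (dot u u).

Definition unit_vector (R : realType) (u : R * R) : R * R :=
  (u.1 / enorm u, u.2 / enorm u).

Definition angle (R : realType) (u v : R * R) : R :=
  acos (dot u v / (enorm u * enorm v)).

(* An ellipse in arbitrary position: its principal axes are directed by
   (cos tilt, sin tilt) and (- sin tilt, cos tilt).  Circles are included. *)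
Record ellipse (R : realType) := Ellipse {
  center : R * R;
  tilt : R;
  semi_a : R;
  semi_b : R;
  semi_a_gt0 : 0 < semi_a;
  semi_b_gt0 : 0 < semi_b }.

Definition axis_a (R : realType) (E : ellipse R) : R * R :=
  (cos (tilt E), sin (tilt E)).

Definition axis_b (R : realType) (E : ellipse R) : R * R :=
  (- sin (tilt E), cos (tilt E)).

Definition xcoord (R : realType) (E : ellipse R) (P : R * R) : R :=
  dot (P - center E) (axis_a E).

Definition ycoord (R : realType) (E : ellipse R) (P : R * R) : R :=
  dot (P - center E) (axis_b E).

Definition on_ellipse (R : realType) (E : ellipse R) (P : R * R) : Prop :=
  xcoord E P ^+ 2 / semi_a E ^+ 2 + ycoord E P ^+ 2 / semi_b E ^+ 2 = 1.

(* Half the gradient, at P, of the quadratic equation of E; it points outwards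
   when P is on E. *)
Definition normal_vector (R : realType) (E : ellipse R) (P : R * R) : R * R :=
  let x := xcoord E P / semi_a E ^+ 2 in
  let y := ycoord E P / semi_b E ^+ 2 in
  (x * (axis_a E).1 + y * (axis_b E).1, x * (axis_a E).2 + y * (axis_b E).2).

Definition outer_normal_direction (R : realType) (E : ellipse R) (P : R * R)
    (psi : R) : Prop :=
  (cos psi, sin psi) = unit_vector (normal_vector E P).

Definition tangent_vector (R : realType) (E : ellipse R) (P : R * R) : R * R :=
  (- (normal_vector E P).2, (normal_vector E P).1).

(* The two segments make equal angles with the two opposite rays of the tangent
   line at P; using the same ray twice would describe a trajectory that
   backtracks. *)
Definition reflects_at (R : realType) (E : ellipse R) (A P B : R * R) : Prop :=
  angle (A - P) (- tangent_vector E P) = angle (B - P) (tangent_vector E P).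

(* Vertices are indexed cyclically: ordS and ord_pred are the successor and the
   predecessor modulo n. *)
Definition billiard_polygon (R : realType) (E : ellipse R) (n : nat)
    (M : 'I_n -> R * R) : Prop :=
  [/\ forall i, on_ellipse E (M i),
      forall i, M i <> M (ordS i) &
      forall i, reflects_at E (M (ord_pred i)) (M i) (M (ordS i))].

(* The conics confocal with E are
     x ^ 2 / (a ^ 2 - lam) + y ^ 2 / (b ^ 2 - lam) = 1
   in the principal coordinates of E: ellipses if lam < min (a ^ 2, b ^ 2),
   hyperbolas if lam lies strictly between a ^ 2 and b ^ 2, and no real point
   if lam > max (a ^ 2, b ^ 2). *)
Definition confocal_parameter (R : realType) (E : ellipse R) (lam : R) : Prop :=
  lam <> semi_a E ^+ 2 /\ lam <> semi_b E ^+ 2.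

(* The line AB is the tangent of the confocal conic at its point with
   homogeneous principal coordinates [X : Y : Z].  Points at infinity (Z = 0)
   account for the asymptotes of the hyperbolas: a side of a polygon of the
   family may lie on an asymptote of the caustic. *)
Definition side_tangent_to_confocal (R : realType) (E : ellipse R) (lam : R)
    (A B : R * R) : Prop :=
  let p := semi_a E ^+ 2 - lam in
  let q := semi_b E ^+ 2 - lam in
  exists X Y Z : R,
    [/\ (X, Y, Z) <> (0, 0, 0),
        X ^+ 2 / p + Y ^+ 2 / q = Z ^+ 2,
        X * xcoord E A / p + Y * ycoord E A / q = Z &
        X * xcoord E B / p + Y * ycoord E B / q = Z].

Definition billiard_family (R : realType) (E : ellipse R) (lam : R) (n : nat)
    (M : 'I_n -> R * R) : Prop :=
  billiard_polygon E M /\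
  forall i, side_tangent_to_confocal E lam (M i) (M (ordS i)).

Definition beta (R : realType) (n : nat) (psi : 'I_n -> R) (i : 'I_n) : R :=
  pi - (psi (ordS i) - psi i).

(* Main.v *)
Require Import Defs.
From mathcomp Require Import all_boot all_order all_algebra.
From mathcomp Require Import ring lra.
From mathcomp Require Import reals trigo.

Set Implicit Arguments.
Unset Strict Implicit.
Unset Printing Implicit Defensive.

Import Order.TTheory GRing.Theory Num.Theory.

Local Open Scope ring_scope.

(** An affine change of coordinates along the axes turns the ellipse into the
unit circle: the point with eccentric angle [t] becomes [(cos t, sin t)].  Write
[A = 1 / a ^ 2], [B = 1 / b ^ 2], let [m i] be the image of [M i] and put
[s u v = 1 - u.v].  The chord from [m i] to [m (i + 1)] is tangent to the caustic
exactly when a certain symmetric form [G (m i) (m (i + 1))] vanishes; [G] is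
affine in each variable, and [G u u = - 2 lam N u] where
[N u = A u_1 ^ 2 + B u_2 ^ 2] is the squared length of the normal at [u].

On tangent chords the dot product of the two normals is [s u v] times a constant
that depends on [A], [B] and [lam] only.  The product of the cosines is thus a
power of this constant times [prod_i s (m i) (m (i + 1)) / prod_i N (m i)], and
this ratio has to be shown equal for any two polygons [m], [m'] of the family.
No deformation of one polygon into the other is used; they are compared directly.

For fixed [u = m i], the function [G u] on the circle is affine and vanishes
exactly at the two neighbours [p], [q] of [u] (doubly when they coincide).  The
function [v |-> s v p * s v q] has the same zeros as [(G u) ^ 2], so the two are
proportional, and evaluation at [v = u] gives the factor:
[(G u v) ^ 2 * s u p * s u q = 4 lam ^ 2 * (N u) ^ 2 * s v p * s v q]
(affine_sqr_versine, sqr_tangency_neighbours).  Take [v = m' i], then exchange the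
two polygons; as [G] is symmetric, it can be eliminated (cross_ratio).  In the
product over [i] of the resulting identities, the factors that involve both
polygons are the numbers [s (m i) (m' (i + 1))] and [s (m i) (m' (i - 1))] on one
side and [s (m (i + 1)) (m' i)] and [s (m (i - 1)) (m' i)] on the other: the same
numbers, up to a cyclic relabelling.  They cancel if none of them is 0, and what
remains is the square of the desired equality between positive numbers
(ratio_of_disjoint_chains).

If the two polygons share a vertex, then there they have the same two neighbours,
hence they are the same cyclic sequence up to a shift and possibly a reversal
(chains_meet), and the ratios agree by reindexing. *)

(** * Points of the unit circle *)

(** The chord between the points with angles [t] and [t'] gives
[2 sin ((t - t') / 2) ^ 2], the rational substitute for the half-angle sine. *)
Definition versine (R : realType) (u v : R * R) : R := 1 - dot u v.

Lemma dotC (R : realType) (u v : R * R) : dot u v = dot v u.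
Proof. by rewrite /dot mulrC [u.2 * _]mulrC. Qed.

Lemma versineC (R : realType) (u v : R * R) : versine u v = versine v u.
Proof. by rewrite /versine dotC. Qed.

Lemma versineE (R : realType) (u v : R * R) :
  dot u u = 1 -> dot v v = 1 ->
  (u.1 - v.1) ^+ 2 + (u.2 - v.2) ^+ 2 = 2 * versine u v.
Proof.
move=> u1 v1.
have -> : (u.1 - v.1) ^+ 2 + (u.2 - v.2) ^+ 2 = dot u u + dot v v - 2 * dot u v.
  by rewrite /dot; ring.
by rewrite u1 v1 /versine; ring.
Qed.

Lemma versine_gt0 (R : realType) (u v : R * R) :
  dot u u = 1 -> dot v v = 1 -> u <> v -> 0 < versine u v.
Proof.
move=> u1 v1 neq; rewrite -(pmulr_rgt0 _ (ltr0n R 2)) -versineE //.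
rewrite lt_def addr_ge0 ?sqr_ge0 // andbT.
apply/negP; rewrite paddr_eq0 ?sqr_ge0 // !sqrf_eq0 !subr_eq0.
by move=> /andP[/eqP e1 /eqP e2]; apply: neq; apply/eqP/andP; rewrite e1 e2.
Qed.

Lemma versine_eq0 (R : realType) (u v : R * R) :
  dot u u = 1 -> dot v v = 1 -> versine u v = 0 -> u = v.
Proof.
move=> u1 v1 uv0; apply/eqP; apply: contraT => /eqP neq.
by have := versine_gt0 u1 v1 neq; rewrite uv0 ltxx.
Qed.

Definition cross (R : realType) (u v : R * R) : R := u.1 * v.2 - u.2 * v.1.

(** Twice the area of the triangle [p q v], which is a 3 x 3 determinant with rows
[(x, y, 1)].  Multiplying that matrix by its transpose for the form
[x x' + y y' - z z'] gives a Gram matrix whose diagonal vanishes on the circle. *)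
Lemma sqr_det3 (R : realType) (p q v : R * R) :
  dot p p = 1 -> dot q q = 1 -> dot v v = 1 ->
  cross (p - q) (p - v) ^+ 2 = 2 * versine p q * versine v p * versine v q.
Proof.
move=> p1 q1 v1.
(* Gram determinant of p, q, v; valid for arbitrary vectors. *)
have -> : cross (p - q) (p - v) ^+ 2 =
  - ((dot p p - 1) * ((dot q q - 1) * (dot v v - 1) - (dot v q - 1) ^+ 2)
     - (dot p q - 1) * ((dot p q - 1) * (dot v v - 1) - (dot v q - 1) * (dot v p - 1))
     + (dot v p - 1) * ((dot p q - 1) * (dot v q - 1) - (dot q q - 1) * (dot v p - 1))).
  by rewrite /cross /dot /=; ring.
by rewrite p1 q1 v1 /versine; ring.
Qed.

(** The square of an affine function with zeros [p] and [q] on the circle is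
proportional to [v |-> versine v p * versine v q].  For [p = q], the condition on
[cross w p] says that the zero line of the function is tangent at [p]. *)
Lemma affine_sqr_versine (R : realType) (c : R) (w p q u v : R * R) :
  dot p p = 1 -> dot q q = 1 -> dot u u = 1 -> dot v v = 1 ->
  dot w p = c -> dot w q = c -> (p = q -> cross w p = 0) ->
  (c - dot w u) ^+ 2 * (versine v p * versine v q) =
  (c - dot w v) ^+ 2 * (versine u p * versine u q).
Proof.
move=> p1 q1 u1 v1 wp wq tgt.
have [/eqP pq|npq] := boolP (p == q).
  have wE x : c - dot w x = c * versine x p.
    have -> : c - dot w x = c - dot w p * dot x p - cross w p * cross x p
      - dot w x * (1 - dot p p) by rewrite /dot /cross; ring.
    by rewrite (tgt pq) p1 wp /versine; ring.
  by rewrite -pq !wE; ring.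
(* The function is a multiple of the signed area of the triangle p q x. *)
have s0 : 0 < versine p q by apply: versine_gt0 => //; apply/eqP.
have detE x : 2 * versine p q * (c - dot w x) = cross (p - q) w * cross (p - q) (p - x).
  rewrite -versineE //.
  have -> : c - dot w x = dot w (p - x) by rewrite -wp /dot /=; ring.
  have -> : ((p.1 - q.1) ^+ 2 + (p.2 - q.2) ^+ 2) * dot w (p - x) =
    (dot w p - dot w q) * dot (p - q) (p - x) + cross (p - q) w * cross (p - q) (p - x).
    by rewrite /dot /cross /=; ring.
  by rewrite wp wq; ring.
have s20 : (2 * versine p q) ^+ 2 != 0 by rewrite expf_neq0 // mulf_neq0 // lt0r_neq0.
have sqE x : dot x x = 1 -> (2 * versine p q) ^+ 2 * (c - dot w x) ^+ 2 =
    cross (p - q) w ^+ 2 * (2 * versine p q * versine x p * versine x q).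
  by move=> x1; rewrite -exprMn detE exprMn sqr_det3.
by apply: (mulfI s20); rewrite ![_ * (_ * (_ * _))]mulrA !sqE //; ring.
Qed.

(** * The tangency form of the caustic *)

(** With eccentric angles [t], [t'] this is
[2 (sin d ^ 2 - lam (A cos c ^ 2 + B sin c ^ 2))] where [c = (t + t') / 2] and
[d = (t - t') / 2]; it vanishes when the chord touches the confocal conic of
parameter [lam]. *)
Definition tangency (R : realType) (A B lam : R) (u v : R * R) : R :=
  versine u v - lam * (A * (1 + (u.1 * v.1 - u.2 * v.2))
                       + B * (1 - (u.1 * v.1 - u.2 * v.2))).

(** The dot product of the normals at two points of the ellipse, in normalized
coordinates. *)
Definition normal_dot (R : realType) (A B : R) (u v : R * R) : R :=
  A * (u.1 * v.1) + B * (u.2 * v.2).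

(** The linear part, up to sign, of the affine function [tangency A B lam u]. *)
Definition polar (R : realType) (A B lam : R) (u : R * R) : R * R :=
  (u.1 * (1 + lam * (A - B)), u.2 * (1 - lam * (A - B))).

Lemma tangencyC (R : realType) (A B lam : R) (u v : R * R) :
  tangency A B lam u v = tangency A B lam v u.
Proof. by rewrite /tangency /versine /dot; ring. Qed.

Lemma tangencyE (R : realType) (A B lam : R) (u v : R * R) :
  tangency A B lam u v = 1 - lam * (A + B) - dot (polar A B lam u) v.
Proof. by rewrite /tangency /versine /dot /=; ring. Qed.

Lemma tangencyuu (R : realType) (A B lam : R) (u : R * R) :
  dot u u = 1 -> tangency A B lam u u = - 2 * lam * normal_dot A B u u.
Proof.
move=> u1.
have -> : tangency A B lam u u =
  (1 - dot u u) * (1 - lam * (A + B)) - 2 * lam * normal_dot A B u u.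
  by rewrite /tangency /versine /normal_dot /dot; ring.
by rewrite u1; ring.
Qed.

(** The half-angle form of [tangency] yields
[A cos t cos t' + B sin t sin t' = (1 / lam - A - B) sin d ^ 2]. *)
Lemma normal_dot_of_tangency (R : realType) (A B lam : R) (u v : R * R) :
  lam != 0 -> tangency A B lam u v = 0 ->
  normal_dot A B u v = (lam^-1 - A - B) / 2 * versine u v.
Proof.
move=> lam0 uv0.
have -> : normal_dot A B u v =
  (lam^-1 - A - B) / 2 * versine u v - (2 * lam)^-1 * tangency A B lam u v.
  by rewrite /tangency /versine /normal_dot /dot; field.
by rewrite uv0 mulr0 subr0.
Qed.

(** What the argument retains of a billiard polygon.  The last clause is the
trace of the law of reflection at a vertex where the trajectory turns back on
itself: [tangency (m i)] has a double zero at the common neighbour. *)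
Definition caustic_chain (R : realType) (A B lam : R) (n : nat)
    (m : 'I_n -> R * R) : Prop :=
  [/\ forall i, dot (m i) (m i) = 1,
      forall i, m i <> m (ordS i),
      forall i, tangency A B lam (m i) (m (ordS i)) = 0 &
      forall i, m (ord_pred i) = m (ordS i) ->
        cross (polar A B lam (m i)) (m (ordS i)) = 0].

Section Chain.
Variables (R : realType) (A B lam : R) (n : nat).
Hypotheses (A_gt0 : 0 < A) (B_gt0 : 0 < B) (lam_neq0 : lam != 0).

Lemma normal_dot_gt0 (u : R * R) : dot u u = 1 -> 0 < normal_dot A B u u.
Proof.
move=> u1; have sq (x : R) : 0 <= x * x by rewrite -expr2 sqr_ge0.
have a0 : 0 <= A * (u.1 * u.1) := mulr_ge0 (ltW A_gt0) (sq _).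
have b0 : 0 <= B * (u.2 * u.2) := mulr_ge0 (ltW B_gt0) (sq _).
rewrite lt_def addr_ge0 // andbT; apply/negP; rewrite paddr_eq0 //.
rewrite !mulf_eq0 !orbb (gt_eqF A_gt0) (gt_eqF B_gt0) => /andP[/eqP u10 /eqP u20].
by move/eqP: u1; rewrite /dot u10 u20 !mul0r addr0 eq_sym oner_eq0.
Qed.

(** Both neighbours of [m i] are zeros of the affine function [tangency (m i)], so
its square is determined by them up to a factor, read off at [m i] itself. *)
Lemma sqr_tangency_neighbours (m : 'I_n -> R * R) (i : 'I_n) (v : R * R) :
  caustic_chain A B lam m -> dot v v = 1 ->
  tangency A B lam (m i) v ^+ 2
    * (versine (m i) (m (ord_pred i)) * versine (m i) (m (ordS i))) =
  4 * lam ^+ 2 * normal_dot A B (m i) (m i) ^+ 2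
    * (versine v (m (ord_pred i)) * versine v (m (ordS i))).
Proof.
case=> m1 mS mc mt v1.
have mc' : tangency A B lam (m i) (m (ord_pred i)) = 0.
  by have := mc (ord_pred i); rewrite ord_predK tangencyC.
transitivity (tangency A B lam (m i) (m i) ^+ 2
  * (versine v (m (ord_pred i)) * versine v (m (ordS i)))); last first.
  by rewrite tangencyuu //; ring.
rewrite (tangencyE _ _ _ _ v) (tangencyE _ _ _ _ (m i)).
apply: affine_sqr_versine => //.
- by move/eqP: mc'; rewrite tangencyE subr_eq0 => /eqP.
- by move/eqP: (mc i); rewrite tangencyE subr_eq0 => /eqP.
- by move=> e; rewrite e; apply: mt.
Qed.

Lemma chain_versine_gt0 (m : 'I_n -> R * R) (i : 'I_n) :
  caustic_chain A B lam m -> 0 < versine (m i) (m (ordS i)).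
Proof. by case=> m1 mS _ _; apply: versine_gt0. Qed.

Lemma chain_versine_pred_gt0 (m : 'I_n -> R * R) (i : 'I_n) :
  caustic_chain A B lam m -> 0 < versine (m i) (m (ord_pred i)).
Proof.
by move=> mP; have := chain_versine_gt0 (ord_pred i) mP; rewrite ord_predK versineC.
Qed.

(** The identities of sqr_tangency_neighbours for [m] at [v = m' i] and for [m'] at
[v = m i] share the factor [tangency (m i) (m' i) ^+ 2].  The equation that
results by eliminating it remains true when this factor is 0, since both sides
then vanish. *)
Lemma cross_ratio (m m' : 'I_n -> R * R) (i : 'I_n) :
  caustic_chain A B lam m -> caustic_chain A B lam m' ->
  versine (m i) (m (ord_pred i)) * versine (m i) (m (ordS i))
    * normal_dot A B (m' i) (m' i) ^+ 2
    * (versine (m i) (m' (ord_pred i)) * versine (m i) (m' (ordS i))) =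
  versine (m' i) (m' (ord_pred i)) * versine (m' i) (m' (ordS i))
    * normal_dot A B (m i) (m i) ^+ 2
    * (versine (m' i) (m (ord_pred i)) * versine (m' i) (m (ordS i))).
Proof.
move=> mP m'P; have [m1 _ _ _] := mP; have [m'1 _ _ _] := m'P.
have E := sqr_tangency_neighbours i mP (m'1 i).
have E' := sqr_tangency_neighbours i m'P (m1 i).
have N0 := lt0r_neq0 (normal_dot_gt0 (m1 i)).
have N0' := lt0r_neq0 (normal_dot_gt0 (m'1 i)).
rewrite tangencyC in E'.
set s := versine (m i) _ * versine (m i) _ in E *.
set s' := versine (m' i) _ * versine (m' i) _ in E' *.
set x := versine (m' i) _ * versine (m' i) (m _) in E *.
set y := versine (m i) _ * versine (m i) _ in E' *.
have k0 : 4 * lam ^+ 2 != 0 by rewrite mulf_neq0 ?pnatr_eq0 // expf_neq0.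
apply: (mulfI k0).
set g := tangency _ _ _ _ _ in E E'; set N := normal_dot _ _ _ _ in E N0 *.
set N' := normal_dot _ _ _ _ in E' N0' *.
transitivity (s * (4 * lam ^+ 2 * N' ^+ 2 * y)); first by ring.
transitivity (s' * (4 * lam ^+ 2 * N ^+ 2 * x)); last by ring.
by rewrite -E -E' mulrCA [s * s']mulrC -mulrCA.
Qed.

(** By sqr_tangency_neighbours, the neighbours of a vertex are the zeros of a
function that depends on the vertex only, so they agree as unordered pairs. *)
Lemma same_neighbours (m m' : 'I_n -> R * R) (i j : 'I_n) :
  caustic_chain A B lam m -> caustic_chain A B lam m' -> m i = m' j ->
  (m (ord_pred i) = m' (ord_pred j) /\ m (ordS i) = m' (ordS j)) \/
  (m (ord_pred i) = m' (ordS j) /\ m (ordS i) = m' (ord_pred j)).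
Proof.
move=> mP m'P mij; have [m1 _ _ _] := mP; have [m'1 _ _ _] := m'P.
have cnd (m2 : 'I_n -> R * R) k v : caustic_chain A B lam m2 -> dot v v = 1 ->
    tangency A B lam (m2 k) v = 0 <-> v = m2 (ord_pred k) \/ v = m2 (ordS k).
  move=> m2P v1; have [m21 _ _ _] := m2P.
  have E := sqr_tangency_neighbours k m2P v1.
  have s0 := mulf_neq0 (lt0r_neq0 (chain_versine_pred_gt0 k m2P))
    (lt0r_neq0 (chain_versine_gt0 k m2P)).
  have N0 : 4 * lam ^+ 2 * normal_dot A B (m2 k) (m2 k) ^+ 2 != 0.
    by rewrite !mulf_neq0 ?pnatr_eq0 ?expf_neq0 // lt0r_neq0 ?normal_dot_gt0.
  split=> [g0|].
    have /eqP : versine v (m2 (ord_pred k)) * versine v (m2 (ordS k)) = 0.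
      by apply: (mulfI N0); rewrite -E g0 mulr0 expr2 !mul0r.
    rewrite mulf_eq0 => /orP[] /eqP v0; [left|right]; exact: versine_eq0.
  have vv u : dot u u = 1 -> versine u u = 0 by move=> u1; rewrite /versine u1 subrr.
  move=> h; apply/eqP; rewrite -sqrf_eq0; apply/eqP/(mulIf s0); rewrite E mul0r.
  by case: h => ->; rewrite vv ?mul0r ?mulr0.
have tr v : dot v v = 1 ->
    (v = m (ord_pred i) \/ v = m (ordS i)) <-> (v = m' (ord_pred j) \/ v = m' (ordS j)).
  by move=> v1; rewrite -!cnd // mij.
have [/(_ (or_introl erefl)) a _] := tr _ (m1 (ord_pred i)).
have [/(_ (or_intror erefl)) b _] := tr _ (m1 (ordS i)).
have [_ /(_ (or_introl erefl)) c] := tr _ (m'1 (ord_pred j)).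
have [_ /(_ (or_intror erefl)) d] := tr _ (m'1 (ordS j)).
by intuition congruence.
Qed.
End Chain.

(** * Comparison of two polygons of the family *)

Lemma ordS_addr1 (n : nat) (i : 'I_n.+2) : ordS i = i + 1.
Proof. by apply: val_inj; rewrite /= modnDmr addn1. Qed.

Lemma ord_pred_subr1 (n : nat) (i : 'I_n.+2) : ord_pred i = i - 1.
Proof. by apply: (@ordS_inj n.+2); rewrite ord_predK ordS_addr1 subrK. Qed.

Section Invariance.
Variables (R : realType) (A B lam : R).
Hypotheses (A_gt0 : 0 < A) (B_gt0 : 0 < B) (lam_neq0 : lam != 0).

(** Once two consecutive vertices agree, same_neighbours propagates the agreement
along the polygon; the first step decides between a shift and a reversal. *)
Lemma chains_meet (n : nat) (m m' : 'I_n.+2 -> R * R) (i j : 'I_n.+2) :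
  caustic_chain A B lam m -> caustic_chain A B lam m' -> m i = m' j ->
  (forall k, m (i + k) = m' (j + k)) \/ (forall k, m (i + k) = m' (j - k)).
Proof.
move=> mP m'P mij.
have nb i1 j1 := @same_neighbours R A B lam n.+2 A_gt0 B_gt0 lam_neq0 m m' i1 j1 mP m'P.
case: (nb i j mij) => [[_]|[_]]; rewrite ?ordS_addr1 ?ord_pred_subr1 => e; [left|right].
  have H (k : nat) : m (i + k%:R) = m' (j + k%:R) /\ m (i + k%:R + 1) = m' (j + k%:R + 1).
    elim: k => [|k [e0 e1]]; first by rewrite !addr0.
    rewrite -natr1 !addrA; split=> //.
    case: (nb _ _ e1) => [[_]|[]]; rewrite !ordS_addr1 ?ord_pred_subr1 ?addrK //.
    by move=> ea ->; rewrite -e0.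
  by move=> k; have [] := H k; rewrite natr_Zp.
have H (k : nat) : m (i + k%:R) = m' (j - k%:R) /\ m (i + k%:R + 1) = m' (j - k%:R - 1).
  elim: k => [|k [e0 e1]]; first by rewrite !subr0 !addr0.
  rewrite -natr1 opprD !addrA; split=> //.
  case: (nb _ _ e1) => [[]|[_]]; rewrite !ordS_addr1 ?ord_pred_subr1 ?addrK ?subrK //.
  by move=> ea ->; rewrite -e0.
by move=> k; have [] := H k; rewrite natr_Zp.
Qed.

Definition versine_normal_ratio (n : nat) (m : 'I_n -> R * R) : R :=
  (\prod_(i < n) versine (m i) (m (ordS i))) / \prod_(i < n) normal_dot A B (m i) (m i).

Lemma ratio_of_meeting_chains (n : nat) (m m' : 'I_n.+2 -> R * R) (i j : 'I_n.+2) :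
  caustic_chain A B lam m -> caustic_chain A B lam m' -> m i = m' j ->
  versine_normal_ratio m = versine_normal_ratio m'.
Proof.
move=> mP m'P mij; rewrite /versine_normal_ratio.
rewrite (reindex_inj (addrI i)) [\prod_i normal_dot _ _ _ _](reindex_inj (addrI i)) /=.
case: (chains_meet mP m'P mij) => e.
  rewrite [in RHS](reindex_inj (addrI j)) [X in _ = _ / X](reindex_inj (addrI j)) /=.
  congr (_ / _); apply: eq_bigr => k _; last by rewrite !e.
  by rewrite !ordS_addr1 -!addrA !e.
(* A reversal maps the side that starts at i + k to the side that ends at j - k,
   hence starts at j - (k + 1). *)
have inj1 : injective (fun k => j - (k + 1)).
  by move=> x y /addrI /oppr_inj /addIr.
have inj2 : injective (fun k => j - k) by move=> x y /addrI /oppr_inj.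
rewrite [in RHS](reindex_inj inj1) [X in _ = _ / X](reindex_inj inj2) /=.
congr (_ / _); apply: eq_bigr => k _; last by rewrite !e.
by rewrite !ordS_addr1 -!addrA !e versineC opprD !addrA subrK.
Qed.

(** In the product of the cross_ratio identities, the factors that involve both
polygons are the same on the two sides after a cyclic relabelling.  Disjointness
makes them nonzero, so they cancel. *)
Lemma ratio_of_disjoint_chains (n : nat) (m m' : 'I_n -> R * R) :
  caustic_chain A B lam m -> caustic_chain A B lam m' ->
  (forall i j, m i <> m' j) ->
  versine_normal_ratio m = versine_normal_ratio m'.
Proof.
move=> mP m'P neq; have [m1 _ _ _] := mP; have [m'1 _ _ _] := m'P.
have pred_prod (F : 'I_n -> R) : \prod_i F (ord_pred i) = \prod_i F i.
  by rewrite [RHS](reindex_inj (@ord_pred_inj n)).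
have S_prod (F : 'I_n -> R) : \prod_i F (ordS i) = \prod_i F i.
  by rewrite [RHS](reindex_inj (@ordS_inj n)).
have s_pos (m2 : 'I_n -> R * R) : caustic_chain A B lam m2 ->
    0 < \prod_i versine (m2 i) (m2 (ordS i)).
  by move=> m2P; apply: prodr_gt0 => i _; apply: chain_versine_gt0 m2P.
have N_pos (m2 : 'I_n -> R * R) : caustic_chain A B lam m2 ->
    0 < \prod_i normal_dot A B (m2 i) (m2 i).
  by move=> [m21 _ _ _]; apply: prodr_gt0 => i _; apply: normal_dot_gt0.
have back (m2 : 'I_n -> R * R) : \prod_i versine (m2 i) (m2 (ord_pred i)) =
    \prod_i versine (m2 i) (m2 (ordS i)).
  rewrite -S_prod; apply: eq_bigr => i _.
  by rewrite ordSK versineC.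
have backward : \prod_i versine (m' i) (m (ordS i)) = \prod_i versine (m i) (m' (ord_pred i)).
  by rewrite -pred_prod; apply: eq_bigr => i _; rewrite ord_predK versineC.
have forward : \prod_i versine (m' i) (m (ord_pred i)) = \prod_i versine (m i) (m' (ordS i)).
  by rewrite -S_prod; apply: eq_bigr => i _; rewrite ordSK versineC.
have : \prod_i (versine (m i) (m (ord_pred i)) * versine (m i) (m (ordS i))
    * normal_dot A B (m' i) (m' i) ^+ 2
    * (versine (m i) (m' (ord_pred i)) * versine (m i) (m' (ordS i)))) =
  \prod_i (versine (m' i) (m' (ord_pred i)) * versine (m' i) (m' (ordS i))
    * normal_dot A B (m i) (m i) ^+ 2
    * (versine (m' i) (m (ord_pred i)) * versine (m' i) (m (ordS i)))).
  by apply: eq_bigr => i _; exact: (cross_ratio A_gt0 B_gt0 lam_neq0 i mP m'P).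
rewrite !big_split /= !back forward backward.
have x0 : 0 < \prod_i versine (m i) (m' (ord_pred i)).
  by apply: prodr_gt0 => i _; apply: versine_gt0; [exact: m1 | exact: m'1 | exact: neq].
have y0 : 0 < \prod_i versine (m i) (m' (ordS i)).
  by apply: prodr_gt0 => i _; apply: versine_gt0; [exact: m1 | exact: m'1 | exact: neq].
rewrite [X in _ = _ * X]mulrC => /(mulIf (lt0r_neq0 (mulr_gt0 x0 y0))).
have s0 := s_pos _ mP; have s0' := s_pos _ m'P.
have N0 := N_pos _ mP; have N0' := N_pos _ m'P.
rewrite /versine_normal_ratio -!expr2 -!exprMn => /eqP.
rewrite eqrXn2 ?mulr_ge0 ?ltW // => /eqP e.
by apply/eqP; rewrite eqr_div ?lt0r_neq0 // e.
Qed.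
End Invariance.

(** * From billiard polygons to chains *)

(** [U x + V y = Z] is the line through [u] and [v]; the first equation says that
the line lies on the dual conic of the caustic.  Eliminate: [(U, V)] is orthogonal
to [u - v] and parallel to [u + v], which expresses [U ^+ 2], [V ^+ 2] and [Z ^+ 2]
up to a common factor through [u] and [v]. *)
Lemma tangency_of_tangent_chord (R : realType) (A B lam U V Z : R) (u v : R * R) :
  dot u u = 1 -> dot v v = 1 -> u <> v -> 0 < U ^+ 2 + V ^+ 2 ->
  U ^+ 2 * (1 - lam * A) + V ^+ 2 * (1 - lam * B) = Z ^+ 2 ->
  U * u.1 + V * u.2 = Z -> U * v.1 + V * v.2 = Z ->
  tangency A B lam u v = 0.
Proof.
move=> u1 v1 neq W0 tgt hu hv.
set W := U ^+ 2 + V ^+ 2 in W0.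
have s0 := versine_gt0 u1 v1 neq.
have uE : u.1 ^+ 2 = 1 - u.2 ^+ 2 by rewrite -u1 /dot; ring.
have vE : v.1 ^+ 2 = 1 - v.2 ^+ 2 by rewrite -v1 /dot; ring.
have perp : U * (u.1 - v.1) = - (V * (u.2 - v.2)).
  by apply/eqP; rewrite -addr_eq0 !mulrBr addrACA -opprD hu hv subrr.
have d2E : (u.2 - v.2) ^+ 2 = versine u v * (1 + (u.1 * v.1 - u.2 * v.2)).
  have -> : versine u v * (1 + (u.1 * v.1 - u.2 * v.2)) =
    (1 - u.2 * v.2) ^+ 2 - u.1 ^+ 2 * v.1 ^+ 2 by rewrite /versine /dot; ring.
  by rewrite uE vE; ring.
have d1E : (u.1 - v.1) ^+ 2 = versine u v * (1 - (u.1 * v.1 - u.2 * v.2)).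
  by have := versineE u1 v1; rewrite d2E; lra.
have U2 : 2 * versine u v * U ^+ 2 = W * (u.2 - v.2) ^+ 2.
  have -> : W * (u.2 - v.2) ^+ 2 = U ^+ 2 * (u.2 - v.2) ^+ 2 + (- (V * (u.2 - v.2))) ^+ 2.
    by rewrite /W; ring.
  by rewrite -perp -versineE //; ring.
have V2 : 2 * versine u v * V ^+ 2 = W * (u.1 - v.1) ^+ 2.
  have -> : W * (u.1 - v.1) ^+ 2 = (U * (u.1 - v.1)) ^+ 2 + V ^+ 2 * (u.1 - v.1) ^+ 2.
    by rewrite /W; ring.
  by rewrite perp -versineE //; ring.
have crs : U * (u.2 + v.2) - V * (u.1 + v.1) = 0.
  have h : (2 * versine u v) * (U * (u.2 + v.2) - V * (u.1 + v.1)) =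
    (U * (u.1 - v.1) + V * (u.2 - v.2)) * cross (u - v) (u + v)
    + (dot u u - dot v v) * (U * (u.2 - v.2) - V * (u.1 - v.1)).
    by rewrite -versineE // /dot /cross /=; ring.
  apply/eqP; move/eqP: h; rewrite perp addNr mul0r u1 v1 subrr mul0r addr0.
  by rewrite mulf_eq0 mulf_eq0 pnatr_eq0 (gt_eqF s0).
have Z2 : 2 * Z ^+ 2 = W * (2 - versine u v).
  have Zs : 2 * Z = U * (u.1 + v.1) + V * (u.2 + v.2).
    by rewrite !mulrDr addrACA hu hv; ring.
  have h4 : 4 * Z ^+ 2 = W * (dot u u + dot v v + 2 * dot u v)
      - (U * (u.2 + v.2) - V * (u.1 + v.1)) ^+ 2.
    have -> : 4 * Z ^+ 2 = (2 * Z) ^+ 2 by ring.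
    by rewrite Zs /W /dot; ring.
  rewrite crs u1 v1 in h4.
  by move: h4; rewrite /versine; lra.
have k0 : W * versine u v != 0 by rewrite mulf_neq0 // lt0r_neq0.
apply: (mulfI k0); rewrite mulr0.
have -> : W * versine u v * tangency A B lam u v =
  W * versine u v ^+ 2 - lam * (A * (W * (u.2 - v.2) ^+ 2) + B * (W * (u.1 - v.1) ^+ 2)).
  by rewrite d1E d2E /tangency; ring.
rewrite -U2 -V2.
have -> : W * versine u v ^+ 2 - lam * (A * (2 * versine u v * U ^+ 2)
    + B * (2 * versine u v * V ^+ 2)) =
  versine u v * (2 * (U ^+ 2 * (1 - lam * A) + V ^+ 2 * (1 - lam * B))
    - W * (2 - versine u v)) by rewrite /W; ring.
by rewrite tgt Z2; ring.
Qed.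

(** The derivative of [tangency A B lam u] along the circle at [v] is, up to sign,
[cross (polar A B lam u) v].  Eliminating [lam] between it and
[tangency A B lam u v = 0] leaves the condition that the chord is normal to the
ellipse at [u]; so the endpoint of a normal chord is a double zero. *)
Lemma double_zero_of_normal_chord (R : realType) (A B lam : R) (u v : R * R) :
  dot u u = 1 -> dot v v = 1 -> u <> v -> tangency A B lam u v = 0 ->
  A * u.1 * (v.2 - u.2) = B * u.2 * (v.1 - u.1) ->
  cross (polar A B lam u) v = 0.
Proof.
move=> u1 v1 neq uv0 perp.
have s0 := lt0r_neq0 (versine_gt0 u1 v1 neq).
apply: (mulfI s0); rewrite mulr0.
have -> : versine u v * cross (polar A B lam u) v =
  tangency A B lam u v * cross u v
  + 2 * lam * (A * u.1 * (v.2 - u.2 * dot v v) - B * u.2 * (v.1 * dot u u - u.1 * dot v v)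
     + B * v.1 * u.2 * (dot u u - 1)).
  by rewrite /tangency /versine /cross /dot /=; ring.
by rewrite uv0 u1 v1 !mulr1 perp; ring.
Qed.

Lemma dot_sqr_le (R : realType) (u v : R * R) : dot u v ^+ 2 <= dot u u * dot v v.
Proof.
rewrite -subr_ge0.
have -> : dot u u * dot v v - dot u v ^+ 2 = cross u v ^+ 2 by rewrite /dot /cross; ring.
exact: sqr_ge0.
Qed.

Lemma dotuu_ge0 (R : realType) (u : R * R) : 0 <= dot u u.
Proof. by rewrite addr_ge0 // -expr2 sqr_ge0. Qed.

Lemma cos_angle (R : realType) (u v : R * R) : cos (angle u v) = dot u v / (enorm u * enorm v).
Proof.
rewrite /angle acosK // in_itv /= -ler_norml normrM normfV.
rewrite /enorm -sqrtrM ?dotuu_ge0 //.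
set D := Num.sqrt _.
have [->|D0] := eqVneq D 0; first by rewrite normr0 invr0 mulr0 ler01.
have Dgt0 : 0 < D by rewrite lt_def D0 sqrtr_ge0.
rewrite (gtr0_norm Dgt0) ler_pdivrMr // mul1r -sqrtr_sqr.
by rewrite ler_wsqrtr // dot_sqr_le.
Qed.

(** [acos (- x) = acos x] forces [x = 0]. *)
Lemma dot_of_angleN (R : realType) (u t : R * R) : angle u (- t) = angle u t -> dot u t = 0.
Proof.
move/(congr1 cos); rewrite !cos_angle.
have -> : enorm (- t) = enorm t.
  by rewrite /enorm; congr Num.sqrt; rewrite /dot /=; ring.
have -> : dot u (- t) = - dot u t by rewrite /dot /=; ring.
rewrite mulNr => /eqP; rewrite eq_sym -addr_eq0 -mulr2n mulrn_eq0 /= mulf_eq0.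
case/orP=> [/eqP //|]; rewrite invr_eq0 mulf_eq0 /enorm !sqrtr_eq0.
move=> D0; apply/eqP; rewrite -sqrf_eq0 eq_le sqr_ge0 andbT.
apply: le_trans (dot_sqr_le _ _) _.
by case/orP: D0 => D0; [apply: mulr_le0_ge0 | apply: mulr_ge0_le0]; rewrite ?dotuu_ge0.
Qed.

Section Geometry.
Variables (R : realType) (E : ellipse R).
Let a := semi_a E.
Let b := semi_b E.
Let A := (a ^+ 2)^-1.
Let B := (b ^+ 2)^-1.

(** For [P] on the ellipse, this is [(cos t, sin t)] with [t] the eccentric angle. *)
Definition eccentric_point (P : R * R) : R * R :=
  (xcoord E P / semi_a E, ycoord E P / semi_b E).

Let a_neq0 : a != 0. Proof. exact/lt0r_neq0/semi_a_gt0. Qed.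
Let b_neq0 : b != 0. Proof. exact/lt0r_neq0/semi_b_gt0. Qed.

Lemma eccentric_point_unit (P : R * R) :
  on_ellipse E P -> dot (eccentric_point P) (eccentric_point P) = 1.
Proof. by move=> <-; rewrite /dot /= -!expr2 !exprMn !exprVn. Qed.

Lemma eccentric_point_inj : injective eccentric_point.
Proof.
move=> P Q [] /(mulIf (invr_neq0 a_neq0)) ex /(mulIf (invr_neq0 b_neq0)) ey.
have coord1 (S : R * R) :
    S.1 = (center E).1 + xcoord E S * cos (tilt E) - ycoord E S * sin (tilt E).
  have -> : S.1 = (center E).1 + (S.1 - (center E).1) * (cos (tilt E) ^+ 2 + sin (tilt E) ^+ 2).
    by rewrite cos2Dsin2; ring.
  by rewrite /xcoord /ycoord /dot /=; ring.
have coord2 (S : R * R) :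
    S.2 = (center E).2 + xcoord E S * sin (tilt E) + ycoord E S * cos (tilt E).
  have -> : S.2 = (center E).2 + (S.2 - (center E).2) * (cos (tilt E) ^+ 2 + sin (tilt E) ^+ 2).
    by rewrite cos2Dsin2; ring.
  by rewrite /xcoord /ycoord /dot /=; ring.
by apply/eqP/andP; rewrite coord1 coord2 ex ey -coord1 -coord2 !eqxx.
Qed.

Lemma dot_normal_vector (P Q : R * R) :
  dot (normal_vector E P) (normal_vector E Q) =
  normal_dot A B (eccentric_point P) (eccentric_point Q).
Proof.
transitivity ((cos (tilt E) ^+ 2 + sin (tilt E) ^+ 2)
  * normal_dot A B (eccentric_point P) (eccentric_point Q)); last by rewrite cos2Dsin2 mul1r.
rewrite /dot /normal_vector /normal_dot /A /B /eccentric_point /a /b /=.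
by field; rewrite a_neq0 b_neq0.
Qed.

Lemma tangency_of_tangent_side (lam : R) (P Q : R * R) :
  confocal_parameter E lam -> on_ellipse E P -> on_ellipse E Q -> P <> Q ->
  side_tangent_to_confocal E lam P Q ->
  tangency A B lam (eccentric_point P) (eccentric_point Q) = 0.
Proof.
move=> [/eqP pn /eqP qn] EP EQ neq [X [Y [Z [nz tgt hP hQ]]]].
have p0 : a ^+ 2 - lam != 0 by rewrite subr_eq0 eq_sym.
have q0 : b ^+ 2 - lam != 0 by rewrite subr_eq0 eq_sym.
apply: (@tangency_of_tangent_chord R A B lam (X * a / (a ^+ 2 - lam))
  (Y * b / (b ^+ 2 - lam)) Z).
- exact: eccentric_point_unit.
- exact: eccentric_point_unit.
- by move/eccentric_point_inj.
- rewrite lt_def addr_ge0 ?sqr_ge0 // andbT; apply/negP.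
  rewrite paddr_eq0 ?sqr_ge0 // !sqrf_eq0 !mulf_eq0 !invr_eq0.
  rewrite (negPf p0) (negPf q0) (negPf a_neq0) (negPf b_neq0) !orbF.
  case/andP=> /eqP X0 /eqP Y0; apply: nz.
  by rewrite -hP X0 Y0 !mul0r addr0.
- by rewrite -tgt /A /B /a /b /=; field; rewrite p0 q0 a_neq0 b_neq0.
- by rewrite -hP /a /b /=; field; rewrite p0 q0 a_neq0 b_neq0.
- by rewrite -hQ /a /b /=; field; rewrite p0 q0 a_neq0 b_neq0.
Qed.

(** If the incoming and the outgoing segments coincide, equal angles with opposite
rays of the tangent force the segment to be normal to the ellipse; this is the
resulting orthogonality in normalized coordinates. *)
Lemma normal_chord_of_bounce_back (P Q : R * R) :
  reflects_at E Q P Q ->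
  A * (eccentric_point P).1 * ((eccentric_point Q).2 - (eccentric_point P).2) =
  B * (eccentric_point P).2 * ((eccentric_point Q).1 - (eccentric_point P).1).
Proof.
move/dot_of_angleN => h; apply/eqP; rewrite -subr_eq0; apply/eqP.
rewrite -[RHS](mul0r (a * b)^-1) -h.
rewrite /dot /tangent_vector /normal_vector /xcoord /ycoord /A /B /a /b /= /xcoord /ycoord /dot /=.
by field; rewrite a_neq0 b_neq0.
Qed.

Lemma billiard_family_chain (lam : R) (n : nat) (M : 'I_n -> R * R) :
  confocal_parameter E lam -> billiard_family E lam M ->
  caustic_chain A B lam (eccentric_point \o M).
Proof.
move=> lamP [[onE neq refl] tgt].
have conj i : tangency A B lam (eccentric_point (M i)) (eccentric_point (M (ordS i))) = 0.
  exact: tangency_of_tangent_side.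
split=> [i|i|i|i] //=.
- exact: eccentric_point_unit.
- by move/eccentric_point_inj; apply: neq.
- move/eccentric_point_inj => e; apply: double_zero_of_normal_chord => //.
  + exact: eccentric_point_unit.
  + exact: eccentric_point_unit.
  + by move/eccentric_point_inj; apply: neq.
  + by apply: normal_chord_of_bounce_back; have := refl i; rewrite e.
Qed.

(** [lam = 0] would make the ellipse its own caustic, and a chord is not tangent to
the ellipse. *)
Lemma caustic_parameter_neq0 (lam : R) (n : nat) (m : 'I_n.+1 -> R * R) :
  caustic_chain A B lam m -> lam != 0.
Proof.
case=> m1 mS mc _; apply/eqP => l0.
have := versine_gt0 (m1 ord0) (m1 _) (mS ord0).
by have := mc ord0; rewrite /tangency l0 mul0r subr0 => ->; rewrite ltxx.
Qed.

Lemma cos_beta (n : nat) (M : 'I_n -> R * R) (psi : 'I_n -> R) (i : 'I_n) :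
  (forall i, outer_normal_direction E (M i) (psi i)) ->
  cos (beta psi i) = - (dot (normal_vector E (M i)) (normal_vector E (M (ordS i)))
     / (enorm (normal_vector E (M i)) * enorm (normal_vector E (M (ordS i))))).
Proof.
move=> h; rewrite /beta addrC cosDpi cosN cosB.
have cosE j : cos (psi j) = (normal_vector E (M j)).1 / enorm (normal_vector E (M j)).
  exact: (congr1 fst (h j)).
have sinE j : sin (psi j) = (normal_vector E (M j)).2 / enorm (normal_vector E (M j)).
  exact: (congr1 snd (h j)).
by rewrite !cosE !sinE invfM /dot; ring.
Qed.

(** Every normal occurs in two consecutive factors, so that the product of the
lengths in the denominators is the product of the squared lengths. *)
Lemma prod_cos_beta (lam : R) (n : nat) (M : 'I_n.+1 -> R * R) (psi : 'I_n.+1 -> R) :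
  confocal_parameter E lam -> billiard_family E lam M ->
  (forall i, outer_normal_direction E (M i) (psi i)) ->
  \prod_i cos (beta psi i) =
  (- ((lam^-1 - A - B) / 2)) ^+ n.+1 * versine_normal_ratio A B (eccentric_point \o M).
Proof.
move=> lamP MF psiP.
have mP := billiard_family_chain lamP MF; have [_ _ mc _] := mP.
have lam0 := caustic_parameter_neq0 mP.
under eq_bigr => i _ do rewrite (cos_beta i psiP) dot_normal_vector
  (normal_dot_of_tangency lam0 (mc i)) -mulNr -mulNr.
rewrite /versine_normal_ratio !big_split /= prodr_const card_ord -mulrA; congr (_ * (_ * _)).
rewrite prodfV; congr (_^-1).
rewrite big_split /= [X in _ * X](_ : _ = \prod_i enorm (normal_vector E (M i))).
  rewrite -big_split /=; apply: eq_bigr => i _.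
  by rewrite -expr2 sqr_sqrtr ?dotuu_ge0 // dot_normal_vector.
by rewrite [RHS](reindex_inj (@ordS_inj n.+1)).
Qed.

End Geometry.

Theorem theorem3p3 (R : realType) (E : ellipse R) (lam : R) (n : nat)
    (M M' : 'I_n -> R * R) (psi psi' : 'I_n -> R) :
  (3 <= n)%N ->
  confocal_parameter E lam ->
  billiard_family E lam M ->
  billiard_family E lam M' ->
  (forall i, outer_normal_direction E (M i) (psi i)) ->
  (forall i, outer_normal_direction E (M' i) (psi' i)) ->
  \prod_(i < n) cos (beta psi i) = \prod_(i < n) cos (beta psi' i).
Proof.
case: n M M' psi psi' => [|[|n]] // M M' psi psi' _ lamP MF MF' psiP psiP'.
have mP := billiard_family_chain lamP MF.
have mP' := billiard_family_chain lamP MF'.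
rewrite (prod_cos_beta lamP MF psiP) (prod_cos_beta lamP MF' psiP'); congr (_ * _).
have A0 : 0 < (semi_a E ^+ 2)^-1 by rewrite invr_gt0 exprn_gt0 ?semi_a_gt0.
have B0 : 0 < (semi_b E ^+ 2)^-1 by rewrite invr_gt0 exprn_gt0 ?semi_b_gt0.
have lam0 := caustic_parameter_neq0 mP.
have [/existsP[i /existsP[j /eqP mij]]|disj] :=
    boolP [exists i, exists j, eccentric_point E (M i) == eccentric_point E (M' j)].
  exact: (ratio_of_meeting_chains A0 B0 lam0 mP mP' mij).
apply: (ratio_of_disjoint_chains A0 B0 lam0 mP mP') => i j mij.
by move/existsP: disj; apply; exists i; apply/existsP; exists j; apply/eqP.
Qed.
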